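(* Any $1f$-specification specifies a random field compatible with it. That is, for every $1f$-specification ${\rm Q}_1^f=\{q_t^z, z\in\widehat{X_t^f}, t\in\mathbb{Z}^d\}$ there exists a unique (positive) random field $P$ whose $1f$-distribution coincides with ${\rm Q}_1^f$, i.e. such that $$\frac{P_{\{t\}\cup S}(xz)}{P_S(z)}=q_t^z(x)$$ for all $t\in\mathbb{Z}^d$, all nonempty $S\in W(\mathbb{Z}^d\setminus\{t\})$, and all $x\in X^t$, $z\in X^S$.
   Context: $X\subset\mathbb{R}$ is a finite set with $1<|X|<\infty$, and $d\ge 1$. For $S\subset\mathbb{Z}^d$, $W(S)$ is the set of all finite subsets of $S$, and $W=W(\mathbb{Z}^d)$. $X^S$ is the set of configurations on $S$ (functions $S\to X$). Braces are omitted for one-point sets, e.g. $X^t=X^{\{t\}}$. For disjoint $S,T$ and $x\in X^S$, $y\in X^T$, $xy\in X^{S\cup T}$ is the concatenation. For $V\in W$, $\widehat{X_V^f}=\bigcup_{\emptyset\neq S\in W(\mathbb{Z}^d\setminus V)}X^S$ (configurations with nonempty finite support outside $V$), and $\widehat{X_t^f}=\widehat{X_{\{t\}}^f}$. A random field is a probability measure $P$ on $X^{\mathbb{Z}^d}$ with the $\sigma$-algebra generated by cylinder sets; $P_V$ denotes its marginal on $X^V$, $V\in W$. All random fields are assumed positive: $P_V(x)>0$ for all $V\in W$, $x\in X^V$. The $1f$-distribution of $P$ is the system $\{Q_t^z, z\in\widehat{X_t^f}, t\in\mathbb{Z}^d\}$ with $Q_t^z(x)=P_{\{t\}\cup S}(xz)/P_S(z)$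 for $z\in X^S$. A $1f$-specification is a system ${\rm Q}_1^f=\{q_t^z, z\in\widehat{X_t^f}, t\in\mathbb{Z}^d\}$ of strictly positive probability distributions $q_t^z$ on $X^t$ such that for all distinct $t,s\in\mathbb{Z}^d$ and all $x\in X^t$, $y\in X^s$, $z\in\widehat{X_{\{t,s\}}^f}$, $$q_t^z(x)\,q_s^{zx}(y)=q_s^z(y)\,q_t^{zy}(x).$$ *)

(* Defs.v *)
From HB Require Import structures.
From mathcomp Require Import all_boot all_order all_algebra finmap.
From mathcomp Require Import all_classical all_reals all_analysis.

Set Implicit Arguments.
Unset Strict Implicit.
Unset Printing Implicit Defensive.
Import Order.TTheory GRing.Theory Num.Theory.
Local Open Scope classical_set_scope.
Local Open Scope ring_scope.

Definition site (d : nat) := 'rV[int]_d.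

(* A configuration with finite support S (an element of X^S) is a finite map
   with domain S.  A configuration on a single site t is identified with its
   value x : X, so that for t outside the domain of z the concatenation xz,
   which lives on {t} U S, is z.[t <- x]. *)
Definition config (R : realType) (X : {fset R}) (d : nat) :=
  {fmap site d -> X}.

(* Configurations with nonempty finite support outside V. *)
Definition Xhat (R : realType) (X : {fset R}) (d : nat) (V : {fset site d}) :
    set (config X d) :=
  [set z | domf z != fset0 /\ [disjoint domf z & V]%fset].

Arguments Xhat {R} X {d} V.

Section Specification.
Context (R : realType) (X : {fset R}) (d : nat).

(* q t z x stands for q_t^z(x).  Only the values with z in Xhat X [fset t] are
   meaningful; no condition below bears on the others. *)
Definition onepoint_system := site d -> config X d -> X -> R.

Definition is_1f_specification (q : onepoint_system) : Prop :=
  (forall (t : site d) (z : config X d), Xhat X [fset t]%fset z ->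
     (forall x : X, 0 < q t z x) /\ \sum_(x : X) q t z x = 1) /\
  (forall (t s : site d) (x y : X) (z : config X d),
     t != s -> Xhat X [fset t; s]%fset z ->
     q t z x * q s z.[t <- x]%fmap y = q s z y * q t z.[s <- y]%fmap x).

End Specification.

Section ConfigurationSpace.
Context (R : realType) (X : {fset R}) (hX : (1 < #|` X|)%N) (d : nat).

Fact spin0 : X.
Proof.
have : (0 < #|` X|)%N by exact: ltnW.
rewrite cardfs_gt0 => /fset0Pn/cid[x xX].
exact: [` xX]%fset.
Qed.

(* X^(Z^d).  Measurable types of the library are pointed; hX provides the
   point. *)
Definition iconfig of (1 < #|` X|)%N := site d -> X.

HB.instance Definition _ := Choice.copy (iconfig hX) (site d -> X).
HB.instance Definition _ := isPointed.Build (iconfig hX) (fun=> spin0).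

Definition restr (V : {fset site d}) (w : iconfig hX) : config X d :=
  [fmap u : V => w (val u)]%fmap.

Definition cylinder : set (set (iconfig hX)) :=
  [set C | exists (V : {fset site d}) (A : set (config X d)),
     C = restr V @^-1` A].

Definition field_space := g_sigma_algebraType cylinder.

Definition random_field := probability field_space R.

(* P_V(x), for x with domain V. *)
Definition marginal (P : random_field) (V : {fset site d}) (x : config X d)
    : R :=
  fine (P (restr V @^-1` [set x])).

Definition positive_field (P : random_field) : Prop :=
  forall (V : {fset site d}) (x : config X d),
    domf x = V -> 0 < marginal P V x.

(* Q_t^z(x) *)
Definition onef_distribution (P : random_field) : onepoint_system X d :=
  fun t z x =>
    marginal P (t |` domf z)%fset z.[t <- x]%fmap / marginal P (domf z) z.

Definition compatible (P : random_field) (q : onepoint_system X d) : Prop :=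
  forall (t : site d) (z : config X d) (x : X),
    Xhat X [fset t]%fset z -> onef_distribution P t z x = q t z x.

(* The library's measures are functions on all subsets, with arbitrary values
   on the non-measurable ones; hence equality is required on the sigma-algebra
   only. *)
Definition same_field (P P' : random_field) : Prop :=
  forall A : set field_space, measurable A -> P A = P' A.

End ConfigurationSpace.

Arguments random_field {R X} hX d.

(* Main.v *)
From HB Require Import structures.
Require Import Defs.
From mathcomp Require Import all_boot all_order all_algebra finmap.
From mathcomp Require Import all_classical all_reals all_analysis.
From mathcomp Require Import ring lra zify.

(** The classical reconstruction of a joint law from its conditionals uses the
    ratio P_t(x) / P_s(y), which compatibility forces to be the odds
    q_t^y(x) / q_s^x(y).  Both halves of the theorem rest on these odds.

    Existence.  Exchanging two sites in the presence of a third gives the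
    cocycle identity [odds_trans]; the lattice is infinite, so a third site is
    always at hand.  Hence 1 / sum_x odds(x, y) does not depend on the auxiliary
    site carrying x, and is a probability law p_s(y) on the spins at s, with
    ratios equal to the odds ([site_law_odds], [site_law_sum1]).  Declaring p to
    be the conditional law given the empty configuration extends the
    specification to all finite configurations: [completion_spec] says
    that the exchange identity persists, and at the empty configuration it is
    exactly the statement about the odds.  Multiplying conditionals one
    site at a time then gives a positive weight w(z) that does not depend on
    the order of the sites, and normalization of the conditionals makes w a
    consistent family of finite-dimensional laws ([weight_set], [weight_sum]).

    The passage from w to a random field is an explicit form of Kolmogorov's
    extension theorem.  The sites are enumerated, and [0, 1[ is cut repeatedly:
    the interval attached to the values at the first n sites has length w of
    these values, and is cut into consecutive intervals by the value at the next
    site.  A point of [0, 1[ lies in exactly one interval of each level, so it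
    spells out a configuration on the whole lattice; the field is the image of
    the Lebesgue measure ([marginal_extension]).

    Uniqueness.  Compatibility determines the marginals of a field by induction
    on the support, as soon as the one-site marginals are known; those have the
    odds as ratios and sum to 1, hence are determined too.  Cylinders are a
    generating class stable under intersection, so equal marginals give equal
    fields ([eq_marginal_same_field]). *)

Set Implicit Arguments.
Unset Strict Implicit.
Unset Printing Implicit Defensive.
Import Order.TTheory GRing.Theory Num.Theory.
Import numFieldNormedType.Exports.
Local Open Scope ring_scope.

(** * Conditional laws on finite configurations *)

(** The elimination behind [odds_trans].  A name such as [tu] stands for the
    conditional at t given the value at u; [ta], [sb], [sg] stand for the
    conditionals given two values, each of which occurs in two of the three
    exchange identities and so disappears from their product. *)
Lemma cycle_cancel (F : fieldType) (tu ta su sb st sg ut us ts : F) :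
  ta != 0 -> sb != 0 -> sg != 0 -> st != 0 -> us != 0 -> ut != 0 ->
  tu * ta = su * sb -> st * sg = ut * ta -> us * sb = ts * sg ->
  (ts / st) * (su / us) = tu / ut.
Proof.
move=> ta0 sb0 sg0 st0 us0 ut0 E1 E2 E3.
have -> : ts = us * sb / sg by rewrite E3 mulfK.
have -> : su = tu * ta / sb by rewrite E1 mulfK.
have -> : st = ut * ta / sg by rewrite -E2 mulfK.
by field; rewrite ut0 us0 ta0 sb0 sg0.
Qed.

Section OnePointSystems.
Context (R : realFieldType) (K : choiceType) (X : finType).
Implicit Types (q : K -> {fmap K -> X} -> X -> R) (z : {fmap K -> X}).
Implicit Types (t s u : K) (x y : X).

(** [D] selects the boundary configurations under which the conditionals are
    constrained: the nonempty ones for a 1f-specification, all of them after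
    completion by one-site laws. *)
Definition specification_on (D : pred {fmap K -> X}) q : Prop :=
  [/\ forall t z x, D z -> t \notin domf z -> 0 < q t z x,
      forall t z, D z -> t \notin domf z -> \sum_x q t z x = 1
    & forall t s x y z, D z -> t != s -> t \notin domf z -> s \notin domf z ->
        q t z x * q s z.[t <- x]%fmap y = q s z y * q t z.[s <- y]%fmap x].

Definition single t x : {fmap K -> X} := [fmap].[t <- x]%fmap.

Lemma dom_single t x s : (s \in domf (single t x)) = (s == t).
Proof. by rewrite /single dom_setf domf0 !inE orbF. Qed.

Lemma single_neq0 t x : domf (single t x) != fset0.
Proof. by apply/fset0Pn; exists t; rewrite dom_single. Qed.

Section SingleSiteLaw.
Context q (hq : specification_on (fun z => domf z != fset0) q).
Context (third_site : forall t s, exists u, (u != t) && (u != s)).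

Definition odds t x s y : R := q t (single s y) x / q s (single t x) y.

Lemma q1_gt0 t s x y : t != s -> 0 < q t (single s y) x.
Proof.
by case: hq => q0 _ _ ts; apply: q0; rewrite ?single_neq0 ?dom_single.
Qed.

Lemma q1_neq0 t s x y : t != s -> q t (single s y) x != 0.
Proof. by move=> ts; rewrite gt_eqF ?q1_gt0. Qed.

Lemma odds_gt0 t x s y : t != s -> 0 < odds t x s y.
Proof. by move=> ts; rewrite divr_gt0 ?q1_gt0// eq_sym. Qed.

Lemma pairC t x s y : t != s ->
  (single t x).[s <- y]%fmap = (single s y).[t <- x]%fmap.
Proof. by move=> ts; rewrite /single setfC eq_sym (negPf ts). Qed.

Lemma q2_neq0 t s u x y a : t != s -> t != u ->
  q t (single s y).[u <- a]%fmap x != 0.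
Proof.
case: hq => q0 _ _ ts tu; rewrite gt_eqF ?q0//.
  by apply/fset0Pn; exists u; rewrite dom_setf !inE eqxx.
by rewrite dom_setf in_fset1U dom_single negb_or ts tu.
Qed.

Lemma q1_exchange t s u x y a : t != s -> t != u -> s != u ->
  q t (single u a) x * q s (single u a).[t <- x]%fmap y =
  q s (single u a) y * q t (single u a).[s <- y]%fmap x.
Proof. by case: hq => _ _ qE ts tu su; rewrite qE ?single_neq0 ?dom_single. Qed.

(** The cocycle identity.  The values at t, s, u are exchanged pairwise, each
    time in the presence of the third one. *)
Lemma odds_trans t x s y u a : t != s -> s != u -> t != u ->
  odds t x s y * odds s y u a = odds t x u a.
Proof.
move=> ts su tu.
have [st us ut] : [/\ s != t, u != s & u != t] by split; rewrite eq_sym.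
have E1 := q1_exchange x y a ts tu su.
have E2 := q1_exchange y a x su st ut.
have E3 := q1_exchange a x y ut us ts.
rewrite (pairC x a tu) in E2; rewrite (pairC y x st) (pairC y a su) in E3.
apply: (cycle_cancel _ _ _ _ _ _ E1 E2 E3).
all: by rewrite ?q1_neq0 ?q2_neq0.
Qed.

(** Inserting the sum over a of q_u^x(a), which is 1, turns the sum over x into
    a double sum; the odds then transfer the conditioning from u to t, and the
    roles of t and u become symmetric. *)
Lemma sum_odds_indep t u s y : t != s -> u != s ->
  \sum_x odds t x s y = \sum_a odds u a s y.
Proof.
have [->//|tu ts us] := eqVneq t u.
have [_ q1 _] := hq.
have sum1 (a b : K) (v : X) : a != b -> \sum_x q a (single b v) x = 1.
  by move=> ab; rewrite q1 ?single_neq0 ?dom_single.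
transitivity (\sum_x \sum_a q t (single u a) x * odds u a s y).
  apply: eq_bigr => x _; rewrite -[LHS]mulr1 -(sum1 u t x) 1?eq_sym//.
  rewrite mulr_sumr; apply: eq_bigr => a _.
  rewrite -(odds_trans x a y tu us ts) {1}/odds mulrAC divfK//.
  by rewrite q1_neq0// eq_sym.
rewrite exchange_big; apply: eq_bigr => a _.
by rewrite -mulr_suml sum1 ?mul1r.
Qed.

Definition other s : K := xchoose (third_site s s).

Lemma other_neq s : other s != s.
Proof. by have /andP[] := xchooseP (third_site s s). Qed.

(** The only value of p(y) for which the masses [odds t x s y] * p(y) on the
    spins x at t = [other s] add up to 1.  By [sum_odds_indep] the choice of t
    is immaterial. *)
Definition site_law s y : R := (\sum_x odds (other s) x s y)^-1.

Lemma sum_odds_gt0 (x0 : X) t s y : t != s -> 0 < \sum_x odds t x s y.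
Proof.
move=> ts; rewrite (bigD1 x0)//= ltr_wpDr ?odds_gt0//.
by apply: sumr_ge0 => x _; rewrite ltW ?odds_gt0.
Qed.

Lemma site_law_gt0 s y : 0 < site_law s y.
Proof. by rewrite invr_gt0 (sum_odds_gt0 y) ?other_neq. Qed.

(** Both laws are computed through a third site u, where the cocycle identity
    compares them. *)
Lemma site_law_odds t x s y : t != s ->
  site_law t x = odds t x s y * site_law s y.
Proof.
move=> ts; have [u /andP[ut us]] := third_site t s.
have tu : t != u by rewrite eq_sym.
rewrite /site_law (sum_odds_indep _ (other_neq t) ut).
rewrite (sum_odds_indep _ (other_neq s) us).
have -> : \sum_a odds u a s y = (\sum_a odds u a t x) * odds t x s y.
  by rewrite mulr_suml; apply: eq_bigr => a _; rewrite odds_trans.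
by rewrite invfM mulrCA mulfV ?mulr1// gt_eqF ?odds_gt0.
Qed.

Lemma site_law_sum1 (x0 : X) t : \sum_x site_law t x = 1.
Proof.
have ot := other_neq t; have to : t != other t by rewrite eq_sym.
under eq_bigr do rewrite (site_law_odds _ x0 to).
rewrite -mulr_suml /site_law.
rewrite (sum_odds_indep _ (other_neq (other t)) to) mulfV// gt_eqF//.
exact: sum_odds_gt0.
Qed.

Definition completion t z x : R :=
  if domf z == fset0 then site_law t x else q t z x.

(** Only the exchange at the empty configuration is new, and it is
    [site_law_odds]; after one site has been added, the configuration is
    nonempty and both sides involve [q] alone. *)
Lemma completion_spec (x0 : X) : specification_on predT completion.
Proof.
have [q0 q1 qE] := hq.
have D0 z : domf z = fset0 -> z = [fmap]%fmap by exact: fmap_nil.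
have Dset z t x : domf z.[t <- x]%fmap != fset0.
  by apply/fset0Pn; exists t; rewrite dom_setf in_fset1U eqxx.
split=> [t z x _ tz|t z _ tz|t s x y z _ ts tz sz]; rewrite /completion.
- by case: ifPn => [_|/q0->//]; rewrite ?site_law_gt0.
- by case: (boolP (_ == _)) => [_|z0]; [exact: site_law_sum1|exact: q1].
rewrite (negPf (Dset z t x)) (negPf (Dset z s y)).
case: ifPn => [/eqP/D0->|z0]; last exact: qE.
rewrite -/(single t x) -/(single s y) (site_law_odds x y ts) /odds.
by rewrite mulrAC divfK 1?mulrC// q1_neq0 1?eq_sym.
Qed.

End SingleSiteLaw.

Section JointWeight.
Context q (hq : specification_on predT q).

(** The chain rule, removing at each step the site that the representation of
    the support lists first; [n] is the size of the support.  The values 1 in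
    the impossible branches are arbitrary. *)
Fixpoint weight_rec n z : R :=
  if n is n'.+1 then
    if enum_fset (domf z) is t :: _ then
      if z.[? t]%fmap is Some x
      then weight_rec n' z.[~ t]%fmap * q t z.[~ t]%fmap x
      else 1
    else 1
  else 1.

Lemma weight_recS n z : weight_rec n.+1 z =
  if enum_fset (domf z) is t :: _ then
    if z.[? t]%fmap is Some x
    then weight_rec n z.[~ t]%fmap * q t z.[~ t]%fmap x
    else 1
  else 1.
Proof. by []. Qed.

Definition weight z : R := weight_rec #|` domf z| z.

Lemma split_site z s : s \in domf z ->
  exists z0 y,
    [/\ s \notin domf z0, z = z0.[s <- y]%fmap & z.[? s]%fmap = Some y].
Proof.
move=> sz; exists z.[~ s]%fmap, z.[sz]%fmap; split.
- by rewrite mem_remfF.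
- by rewrite setf_rem1 (setf_get (FSetSub sz)).
- by rewrite in_fnd.
Qed.

Lemma card_setf z t x : t \notin domf z ->
  #|` domf z.[t <- x]%fmap| = #|` domf z|.+1.
Proof. by move=> tz; rewrite dom_setf cardfsU1 tz. Qed.

(** Any site may be the last one in the chain rule.  If the recursion removes a
    site s other than t, both are last in some order for the configuration
    without them, and the exchange identity swaps them. *)
Lemma weight_rec_set n z t x : #|` domf z| = n -> t \notin domf z ->
  weight_rec n.+1 z.[t <- x]%fmap = weight_rec n z * q t z x.
Proof.
elim: n z t x => [|n IH] z t x zn tz.
all: set z' := z.[t <- x]%fmap; rewrite weight_recS.
(* both cases of the induction inspect the site s removed by the recursion; if
   s is not t, the support of z is nonempty *)
all: have tz' : t \in enum_fset (domf z') by rewrite dom_setf fset1U1.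
all: case Es : (enum_fset _) tz' => [//|s l] _.
all: have sz' : s \in domf z'.
1,3: by rewrite -[_ \in _]/(s \in enum_fset _) Es mem_head.
all: move: sz'; have [-> _|st] := eqVneq s t.
1,3: by rewrite fnd_set eqxx remf1_set eqxx remf1_id.
all: move=> sz'; have : s \in domf z.
1,3: by move: sz'; rewrite dom_setf in_fset1U (negPf st).
  by rewrite (cardfs0_eq zn) in_fset0.
move=> /split_site[z0 [y [sz0 zE zsy]]].
have tz0 : t \notin domf z0.
  by move: tz; rewrite zE dom_setf in_fset1U negb_or => /andP[].
have z0n : #|` domf z0| = n.
  by apply/eqP; rewrite -eqSS -(card_setf y sz0) -zE zn.
rewrite fnd_set (negPf st) zsy remf1_set (negPf st).
rewrite zE remf1_set eqxx remf1_id//.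
rewrite IH// [in RHS]IH// -!mulrA; congr (_ * _).
by case: hq => _ _ ->//; rewrite eq_sym.
Qed.

Lemma weight_set z t x : t \notin domf z ->
  weight z.[t <- x]%fmap = weight z * q t z x.
Proof. by move=> tz; rewrite /weight card_setf// weight_rec_set. Qed.

Lemma weight_nil : weight [fmap]%fmap = 1.
Proof. by rewrite /weight domf0 cardfs0. Qed.

Lemma weight_gt0 z : 0 < weight z.
Proof.
have [q0 _ _] := hq.
elim/fmap_rect: z => [|z IH t x tz]; first by rewrite weight_nil.
by rewrite weight_set// mulr_gt0// q0.
Qed.

Lemma weight_sum z t : t \notin domf z ->
  \sum_x weight z.[t <- x]%fmap = weight z.
Proof.
have [_ q1 _] := hq; move=> tz.
under eq_bigr do rewrite weight_set//.
by rewrite -mulr_sumr q1// mulr1.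
Qed.

End JointWeight.
End OnePointSystems.

(** * Nested intervals with prescribed lengths *)

Section Slices.
Context (R : realFieldType) (X : eqType) (v : X -> R).
Context (v_ge0 : forall x, 0 <= v x).

(** Left end of the slice of [x] when an interval starting at 0 is cut into
    consecutive slices of lengths [v y], for [y] in [s]. *)
Fixpoint before (s : seq X) (x : X) : R :=
  if s is y :: s' then if x == y then 0 else v y + before s' x else 0.

Lemma before_ge0 s x : 0 <= before s x.
Proof. by elim: s => //= y s IH; case: ifP => // _; rewrite addr_ge0. Qed.

Lemma before_le s x : x \in s -> before s x + v x <= \sum_(y <- s) v y.
Proof.
elim: s => //= y s IH; rewrite inE big_cons.
have [->|_ /= /IH] := eqVneq x y; last by rewrite -addrA lerD2l.
by rewrite add0r lerDl sumr_ge0.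
Qed.

Lemma slice_exists s (r : R) : uniq s -> 0 <= r < \sum_(y <- s) v y ->
  exists2 x, x \in s & before s x <= r < before s x + v x.
Proof.
elim: s r => [|y s IH] r; rewrite ?big_nil ?big_cons /=.
  by move=> _ /andP[]; lra.
move=> /andP[ys us] /andP[r0 ry]; have [ry'|yr] := ltP r (v y).
  by exists y; rewrite ?mem_head//= eqxx add0r r0.
have [|x xs xr] := IH (r - v y) us; first lra.
have xy : x != y by apply: contraNneq ys => <-.
by exists x; rewrite ?inE ?xs ?orbT//= (negPf xy); lra.
Qed.

Lemma slice_inj s (r : R) x y : x \in s -> y \in s ->
  before s x <= r < before s x + v x ->
  before s y <= r < before s y + v y -> x = y.
Proof.
elim: s r => //= a s IH r; rewrite !inE.
have [->|_] := eqVneq x a; have [->|_]//= := eqVneq y a.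
- by move=> _ _ ? ?; exfalso; have := before_ge0 s y; lra.
- by move=> _ _ ? ?; exfalso; have := before_ge0 s x; lra.
- by move=> xs ys ? ?; apply: (IH (r - v a)) => //; lra.
Qed.
End Slices.

Section NestedIntervals.
Context (R : realFieldType) (K : countType) (X : finType).
Context (w : {fmap K -> X} -> R).
Context (w_ge0 : forall z, 0 <= w z).
Context (w_nil : w [fmap]%fmap = 1).
Context (w_sum : forall z t, t \notin domf z ->
  \sum_x w z.[t <- x]%fmap = w z).
Implicit Types (z : {fmap K -> X}) (t : K) (x : X) (n : nat) (r : R).

(** The sites with code below [n].  The codes need not fill an initial segment
    of the naturals: a code without a site leaves the window unchanged. *)
Fixpoint window n : {fset K} :=
  if n is n'.+1 then
    if pickle_inv n' is Some t then (t |` window n')%fset else window n'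
  else fset0.

Lemma mem_window n t : (t \in window n) = (choice.pickle t < n)%N.
Proof.
elim: n => [|n IH]; first by rewrite in_fset0.
rewrite ltnS leq_eqVlt -IH /=; case E : (pickle_inv n) => [s|].
  have sn : choice.pickle s = n by have := @pickle_invK K n; rewrite E.
  rewrite in_fset1U; congr (_ || _).
  by rewrite -sn (inj_eq (pcan_inj choice.pickleK)).
case: eqP => // tn; have := pickleK_inv t; by rewrite tn E.
Qed.

Lemma window_le m n : (m <= n)%N -> (window m `<=` window n)%fset.
Proof.
by move=> mn; apply/fsubsetP=> t; rewrite !mem_window => /leq_trans; apply.
Qed.

Lemma sub_window (V : {fset K}) : exists n, (V `<=` window n)%fset.
Proof.
exists (\max_(t <- V) (choice.pickle t).+1)%N; apply/fsubsetP=> t tV.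
by rewrite mem_window (big_rem t)//= leq_max leqnn.
Qed.

Definition extensions z t x := w z.[t <- x]%fmap.

(** Left end of the interval of level [n] attached to [z], for [z] supported by
    [window n]: the last site t cuts the interval of the restriction of [z] to
    the other sites, in the order of the enumeration of [X]. *)
Fixpoint left_end n z : R :=
  if n is n'.+1 then
    if pickle_inv n' is Some t then
      if z.[? t]%fmap is Some x then
        left_end n' z.[~ t]%fmap + before (extensions z.[~ t]%fmap t) (enum X) x
      else 0
    else left_end n' z
  else 0.

Definition in_interval n z r : bool := left_end n z <= r < left_end n z + w z.

Lemma pickle_inv_window n t : pickle_inv n = Some t -> t \notin window n.
Proof.
move=> E; have := @pickle_invK K n.
by rewrite mem_window E /= => ->; rewrite ltnn.
Qed.

Lemma window_splitP n t z : pickle_inv n = Some t -> domf z = window n.+1 ->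
  exists z0 x, domf z0 = window n /\ z = z0.[t <- x]%fmap.
Proof.
move=> nt; rewrite /= nt => zV; have tz : t \in domf z by rewrite zV fset1U1.
exists z.[~ t]%fmap, z.[tz]%fmap; split.
  by rewrite domf_rem zV fsetU1K// pickle_inv_window.
by rewrite setf_rem1 (setf_get (FSetSub tz)).
Qed.

Lemma left_end_set n t z x : pickle_inv n = Some t -> domf z = window n ->
  left_end n.+1 z.[t <- x]%fmap =
  left_end n z + before (extensions z t) (enum X) x.
Proof.
move=> nt zn; have tz : t \notin domf z by rewrite zn pickle_inv_window.
by rewrite /= nt fnd_set eqxx remf1_set eqxx remf1_id.
Qed.

Lemma in_interval_set n t z x r : pickle_inv n = Some t -> domf z = window n ->
  in_interval n.+1 z.[t <- x]%fmap r =
  (before (extensions z t) (enum X) x <= r - left_end n z <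
   before (extensions z t) (enum X) x + extensions z t x).
Proof.
move=> nt zn; rewrite /in_interval left_end_set// -/(extensions z t x).
by rewrite lerBrDl ltrBlDl addrA.
Qed.

(** The slices of an interval do not stick out of it, because their lengths add
    up to its length by consistency of [w]. *)
Lemma in_interval_restrict n z r :
  domf z = window n.+1 -> in_interval n.+1 z r ->
  in_interval n z.[& window n]%fmap r.
Proof.
case nt : (pickle_inv n) => [t|]; last first.
  by rewrite /in_interval /= nt => <-; rewrite restrictfT.
move=> /(window_splitP nt)[z0 [x [z0n ->]]].
rewrite in_interval_set// restrictf_set (negPf (pickle_inv_window nt)).
rewrite -z0n restrictfT.
set v := extensions z0 t => vr.
have tz : t \notin domf z0 by rewrite z0n pickle_inv_window.
have v0 y : 0 <= v y by exact: w_ge0.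
have b0 := before_ge0 v0 (enum X) x; have bw := before_le v0 (mem_enum X x).
move: bw; rewrite big_enum/= w_sum// => bw.
by rewrite /in_interval; lra.
Qed.

Lemma in_interval_unit n z r : domf z = window n -> in_interval n z r ->
  0 <= r < 1.
Proof.
elim: n z => [|n IH] z zn.
  by rewrite (fmap_nil zn) /in_interval w_nil add0r.
move=> /(in_interval_restrict zn)/IH; apply.
by rewrite domf_restrict zn; apply/fsetIidPl/window_le.
Qed.

Lemma in_interval_exists n r : 0 <= r < 1 ->
  exists z, domf z = window n /\ in_interval n z r.
Proof.
move=> r01; elim: n => [|n [z [zn zr]]].
  by exists [fmap]%fmap; rewrite /in_interval w_nil add0r domf0.
case nt : (pickle_inv n) => [t|]; last by exists z; rewrite /in_interval /= nt.
have tz : t \notin domf z by rewrite zn pickle_inv_window.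
have [||x xX xr] :=
  @slice_exists _ _ (extensions z t) (enum X) (r - left_end n z).
- exact: enum_uniq.
- by rewrite big_enum/= w_sum//; move: zr; rewrite /in_interval; lra.
exists z.[t <- x]%fmap; rewrite in_interval_set//; split=> //.
by rewrite dom_setf /= nt zn.
Qed.

Lemma in_interval_inj n z z' r : domf z = window n -> domf z' = window n ->
  in_interval n z r -> in_interval n z' r -> z = z'.
Proof.
elim: n z z' => [|n IH] z z' zn z'n zr z'r.
  by rewrite (fmap_nil zn) (fmap_nil z'n).
have dr (y : {fmap K -> X}) : domf y = window n.+1 ->
    domf y.[& window n]%fmap = window n.
  by move=> yn; rewrite domf_restrict yn; apply/fsetIidPl/window_le.
have zz' := IH _ _ (dr _ zn) (dr _ z'n) (in_interval_restrict zn zr)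
  (in_interval_restrict z'n z'r).
case nt : (pickle_inv n) => [t|]; last first.
  by move: zn z'n zz'; rewrite /= nt => <- z'z; rewrite -{2}z'z !restrictfT.
have [z0 [x [z0n zE]]] := window_splitP nt zn.
have [z1 [x' [z1n zE']]] := window_splitP nt z'n.
move: zz' zr z'r; rewrite zE zE' !restrictf_set (negPf (pickle_inv_window nt)).
rewrite -{1}z0n -z1n !restrictfT => <-; rewrite !in_interval_set// => xr x'r.
by rewrite (slice_inj _ _ _ xr x'r) ?mem_enum// => y; exact: w_ge0.
Qed.

Lemma in_interval_le m n z r : (m <= n)%N -> domf z = window n ->
  in_interval n z r -> in_interval m z.[& window m]%fmap r.
Proof.
elim: n z => [|n IH] z.
  by rewrite leqn0 => /eqP-> zn; rewrite -zn restrictfT.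
rewrite leq_eqVlt => /predU1P[-> zn|mn zn zr]; first by rewrite -zn restrictfT.
have := IH z.[& window n]%fmap mn _ (in_interval_restrict zn zr).
rewrite restrictf_comp.
rewrite ltnS in mn; rewrite (fsetIidPr (window_le mn)); apply.
by rewrite domf_restrict zn; apply/fsetIidPl/window_le.
Qed.

End NestedIntervals.

(** * Random fields and their marginals *)

Local Open Scope classical_set_scope.
Local Open Scope ring_scope.

Section RandomFields.
Context (R : realType) (X : {fset R}) (hX : (1 < #|` X|)%N) (d : nat).
Implicit Types (V : {fset site d}) (t : site d) (z : config X d).
Implicit Types (om : iconfig d hX) (P : random_field hX d).

Lemma fnd_restr V om t :
  (restr V om).[? t]%fmap = if t \in V then Some (om t) else None.
Proof.
case: ifPn => tV; last by rewrite not_fnd.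
by rewrite (in_fnd (tV : t \in domf (restr V om))) ffunE.
Qed.

Lemma restr_restrict (U V : {fset site d}) om : (U `<=` V)%fset ->
  (restr V om).[& U]%fmap = restr U om.
Proof.
move=> UV; apply/fmapP => t; rewrite fnd_restrict !fnd_restr.
by case: ifPn => // /(fsubsetP UV) ->.
Qed.

Lemma restr_setU1 V t om :
  restr (t |` V)%fset om = (restr V om).[t <- om t]%fmap.
Proof.
apply/fmapP => s; rewrite fnd_set !fnd_restr in_fset1U.
by case: eqVneq => // ->.
Qed.

Lemma measurable_cylinder V (A : set (config X d)) :
  measurable (restr V @^-1` A : set (field_space hX d)).
Proof. by apply: sub_sigma_algebra; exists V, A. Qed.

Lemma finite_configs V : finite_set [set z : config X d | domf z = V].
Proof.
apply: (@sub_finite_set _ _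
  ((fun f : {ffun V -> X} => FinMap f : config X d) @` setT)).
  by move=> [D f] /= <-; exists f.
exact/finite_image/finite_finset.
Qed.

(** The spin space being finite, a cylinder is a finite disjoint union of
    elementary ones. *)
Lemma field_cylinder P V (A : set (config X d)) :
  (P (restr V @^-1` A) = \sum_(z \in [set z : config X d | domf z = V] `&` A)
    P (restr V @^-1` [set z]))%E.
Proof.
have fin : finite_set ([set z : config X d | domf z = V] `&` A).
  exact/finite_setIl/finite_configs.
have triv : trivIset ([set z : config X d | domf z = V] `&` A)
    (fun z => restr V @^-1` [set z] : set (field_space hX d)).
  by move=> z z' _ _ [om [/= h1 h2]]; exact: (etrans (esym h1) h2).
have /= <- := measure_fin_bigcup P fin triv
  (fun z _ => measurable_cylinder V [set z]).
congr (P _); apply/seteqP; split => [om /= Aom|om [z [_ Az] /= omz]].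
  by exists (restr (hX := hX) V om).
by rewrite /preimage /= omz.
Qed.

Lemma marginal_EFin P V z : ((marginal P V z)%:E = P (restr V @^-1` [set z]))%E.
Proof.
by rewrite /marginal fineK// fin_num_measure//; exact: measurable_cylinder.
Qed.

Lemma marginal_nil P : marginal P fset0 [fmap]%fmap = 1.
Proof.
rewrite /marginal (_ : _ @^-1` _ = setT) ?probability_setT//.
by apply/seteqP; split=> // om _ /=; apply: fmap_nil.
Qed.

Lemma marginal_sum P V t z : domf z = V -> t \notin V ->
  marginal P V z = \sum_x marginal P (t |` V)%fset z.[t <- x]%fmap.
Proof.
move=> zV tV; apply: EFin_inj; rewrite -sumEFin.
under eq_bigr do rewrite marginal_EFin.
rewrite marginal_EFin (_ : restr V @^-1` _ =
  \bigcup_(x in [set: X]) (restr (t |` V)%fset @^-1` [set z.[t <- x]%fmap])).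
  have fin : finite_set [set: X] by exact: finite_finset.
  have triv : trivIset [set: X] (fun x => restr (t |` V)%fset @^-1`
      [set z.[t <- x]%fmap] : set (field_space hX d)).
    move=> x x' _ _ [om [/= h1 h2]].
    have /(congr1 (fun f : config X d => f.[? t]%fmap)) := etrans (esym h1) h2.
    by rewrite !fnd_set eqxx => -[].
  have /= -> := measure_fin_bigcup P fin triv
    (fun x _ => measurable_cylinder (t |` V)%fset [set z.[t <- x]%fmap]).
  rewrite (fsbigE (enum {: X})) ?enum_uniq//= => [|x _].
    by rewrite big_enum_cond/=; apply: eq_bigl => x; rewrite in_setT.
  by rewrite mem_enum.
apply/seteqP; split=> [om /= omz|om [x _ /= omz]].
  by exists (om t) => //=; rewrite restr_setU1 omz.
rewrite /= -(restr_restrict om (fsubsetU1 t V)) omz restrictf_set (negPf tV).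
by rewrite -zV restrictfT.
Qed.

(** Cylinders are stable under intersection, and the probability of a cylinder
    is a sum of marginals. *)
Lemma eq_marginal_same_field P P' :
  (forall z, marginal P' (domf z) z = marginal P (domf z) z) -> same_field P' P.
Proof.
move=> PP' A mA.
apply: (@measure_unique _ R (field_space hX d) (@cylinder R X hX d)
  (fun=> setT)) => //.
- move=> _ _ [V [B ->]] [V' [B' ->]].
  exists (V `|` V')%fset.
  exists [set z | B z.[& V]%fmap /\ B' z.[& V']%fmap].
  apply/seteqP; split => om /=;
    by rewrite !restr_restrict ?fsubsetUl ?fsubsetUr.
- by move=> _; exists fset0, setT.
- by rewrite bigcup_const//; exists 0%N.
- move=> _ [V [B ->]].
  rewrite -[LHS]/(P' _) -[RHS]/(P _) !field_cylinder.
  apply: eq_fsbigr => z; rewrite inE => -[/= zV _].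
  by rewrite -!marginal_EFin -zV PP'.
- by move=> _; rewrite -[X in (X < _)%E]/(P' _) probability_setT ltry.
Qed.

End RandomFields.

(** * Extension of a consistent family of finite-dimensional laws *)

Section UnitLebesgue.
Context (R : realType).

Lemma measurable_unit_itv :
  measurable (`[0, 1[%classic : set (measurableTypeR R)).
Proof. exact: measurable_itv. Qed.

Definition unit_lebesgue : set (measurableTypeR R) -> \bar R :=
  mrestr lebesgue_measure measurable_unit_itv.

HB.instance Definition _ :=
  Measure.copy unit_lebesgue (mrestr lebesgue_measure measurable_unit_itv).

Lemma unit_lebesgue_setT : unit_lebesgue setT = 1%E.
Proof.
rewrite /unit_lebesgue /mrestr setTI lebesgue_measure_itv/= lte_fin ltr01.
by rewrite oppr0 addr0.
Qed.

HB.instance Definition _ :=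
  Measure_isProbability.Build _ _ _ unit_lebesgue unit_lebesgue_setT.

End UnitLebesgue.

Section Extension.
Context (R : realType) (X : {fset R}) (hX : (1 < #|` X|)%N) (d : nat).
Context (w : config X d -> R).
Context (w_ge0 : forall z, 0 <= w z).
Context (w_nil : w [fmap]%fmap = 1).
Context (w_sum : forall (z : config X d) (t : site d), t \notin domf z ->
  \sum_x w z.[t <- x]%fmap = w z).
Implicit Types (V : {fset site d}) (t : site d) (z : config X d) (r : R).

(** The values at the sites of [window n] spelled out by [r]. *)
Definition reading n r : config X d :=
  xget [fmap]%fmap [set z : config X d |
    domf z = window (site d) n /\ in_interval w n z r].

(** The value at [t] is read at the first level whose window contains [t]; the
    default spin is used only for [r] outside [0, 1[. *)
Definition realization r : iconfig d hX :=
  fun t => odflt (spin0 hX) (reading (choice.pickle t).+1 r).[? t]%fmap.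

Lemma readingP n r : 0 <= r < 1 ->
  domf (reading n r) = window (site d) n /\ in_interval w n (reading n r) r.
Proof.
move=> r01; have [z zP] := in_interval_exists w_nil w_sum n r01.
by rewrite /reading; case: xgetP => [_ _ //|] /(_ z)[].
Qed.

Lemma reading_eq n z r : domf z = window (site d) n -> in_interval w n z r ->
  reading n r = z.
Proof.
move=> zn zr; have r01 := in_interval_unit w_ge0 w_nil w_sum zn zr.
have [pn pr] := readingP n r01.
exact: (in_interval_inj w_ge0 w_sum pn zn pr zr).
Qed.

Lemma reading_restrict m n r : (m <= n)%N -> 0 <= r < 1 ->
  reading m r = (reading n r).[& window (site d) m]%fmap.
Proof.
move=> mn r01; have [pn pr] := readingP n r01; apply: reading_eq.
  by rewrite domf_restrict pn; apply/fsetIidPl/window_le.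
exact: (in_interval_le w_ge0 w_sum mn pn pr).
Qed.

Lemma restr_realization n r : 0 <= r < 1 ->
  restr (window (site d) n) (realization r) = reading n r.
Proof.
move=> r01; have [pn _] := readingP n r01.
have memp t : (t \in reading n r) = (choice.pickle t < n)%N.
  by rewrite -[LHS]/(t \in domf (reading n r)) pn mem_window.
apply/fmapP => t; rewrite fnd_restr mem_window; case: ifPn => tn; last first.
  by rewrite not_fnd// memp.
rewrite /realization (reading_restrict tn r01) fnd_restrict mem_window ltnSn.
by case: fndP => //; rewrite memp tn.
Qed.

Lemma restr_realization_eq n z : domf z = window (site d) n ->
  (restr (window (site d) n) \o realization) @^-1` [set z] `&` `[0, 1[ =
  `[left_end w n z, left_end w n z + w z[%classic.
Proof.
move=> zn; apply/seteqP; split=> r /=; rewrite !in_itv/=.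
  by move=> [<- r01]; rewrite restr_realization//; have [] := readingP n r01.
move=> zr; have r01 := in_interval_unit w_ge0 w_nil w_sum zn zr.
by rewrite r01 restr_realization// (reading_eq zn zr).
Qed.

(** The event that a realization lies in a cylinder over V is a finite union of
    intervals of any level whose window contains V. *)
Lemma measurable_realization :
  measurable_fun (`[0, 1[ : set (measurableTypeR R))
    (realization : R -> field_space hX d).
Proof.
apply: (@measurability _ _ _ (field_space hX d) _ _ (@cylinder R X hX d)) => //.
move=> _ [_ [V [A ->]] <-].
have [n Vn] := sub_window V.
pose F z : set (measurableTypeR R) :=
  `[left_end w n z, left_end w n z + w z[%classic.
pose I := [set z : config X d | domf z = window (site d) n] `&`
  [set z | A z.[& V]%fmap].
rewrite (_ : _ `&` _ = \bigcup_(z in I) F z).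
  apply: fin_bigcup_measurable => [|z _]; last exact: measurable_itv.
  exact/finite_setIl/finite_configs.
apply/seteqP; split=> [r [r01 Ar]|r [z [zn Az]]].
  have r01' : 0 <= r < 1 by move: r01; rewrite /= in_itv.
  have [pn pr] := readingP n r01'.
  exists (reading n r); last by rewrite /F /= in_itv.
  by split=> //=; rewrite -restr_realization// restr_restrict.
rewrite /F -restr_realization_eq// => -[/= rz r01]; split=> //=.
by rewrite -(restr_restrict _ Vn) rz.
Qed.

(** Constant outside [0, 1[, so that measurability on [0, 1[ suffices. *)
Definition total_realization : measurableTypeR R -> field_space hX d :=
  (realization : measurableTypeR R -> field_space hX d) \_ `[0, 1[.

Lemma measurable_total_realization : measurable_fun setT total_realization.
Proof.
apply: (measurable_restrictT _ _).1; last exact: measurable_realization.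
exact: measurable_unit_itv.
Qed.

HB.instance Definition _ :=
  isMeasurableFun.Build _ _ _ _ total_realization measurable_total_realization.

Definition extension : random_field hX d :=
  distribution (@unit_lebesgue R) total_realization.

Lemma extension_window n z : domf z = window (site d) n ->
  marginal extension (window (site d) n) z = w z.
Proof.
move=> zn; rewrite /marginal /extension /= /distribution /pushforward.
rewrite /unit_lebesgue /mrestr.
rewrite (_ : _ `&` _ = `[left_end w n z, left_end w n z + w z[%classic).
  rewrite lebesgue_measure_itv/= lte_fin; case: ifPn => [_|].
    by rewrite -EFinD/= addrAC subrr add0r.
  by rewrite ltrDl -leNgt => wz; apply/eqP; rewrite eq_le w_ge0.
rewrite -restr_realization_eq//; apply/seteqP; split=> r [/= rz r01].
  by split=> //; move: rz; rewrite /total_realization patchT ?inE.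
by split=> //; rewrite /= /total_realization patchT ?inE.
Qed.

(** The construction gives the marginals on windows.  Those on other supports
    follow by summing over the missing sites one by one, since [w] and the
    marginals of a field obey the same consistency relation. *)
Lemma marginal_extension z : marginal extension (domf z) z = w z.
Proof.
have [n zn] := sub_window (domf z).
have [k kE] : exists k, k = #|` window (site d) n `\` domf z|%fset.
  by eexists.
elim: k z zn kE => [|k IH] z zn kE.
  have zE : domf z = window (site d) n.
    apply/eqP; rewrite eqEfsubset zn -fsetD_eq0; apply/eqP/cardfs0_eq.
    by rewrite -kE.
  by rewrite [in LHS]zE extension_window.
have /fset0Pn[t] : (window (site d) n `\` domf z)%fset != fset0.
  by rewrite -cardfs_gt0 -kE.
rewrite in_fsetD => /andP[tz tn].
rewrite (marginal_sum extension (erefl _) tz) -(w_sum tz).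
apply: eq_bigr => x _; rewrite -IH ?dom_setf//.
  by rewrite fsubUset fsub1set tn.
have := cardfsD1 t (window (site d) n `\` domf z)%fset.
by rewrite in_fsetD tz tn -kE add1n fsetDDl fsetUC => -[].
Qed.

End Extension.

(** * Compatible fields *)

Lemma third_site (d : nat) (hd : (1 <= d)%N) (t s : site d) :
  exists u : site d, (u != t) && (u != s).
Proof.
pose i := Ordinal hd; pose c : int := `|t 0 i| + `|s 0 i| + 1.
have cn (v : site d) : v 0 i < c -> const_mx c != v.
  by move=> vc; apply: contraTneq vc => <-; rewrite mxE ltxx.
by exists (const_mx c); rewrite !cn//; lia.
Qed.

Section Compatibility.
Context (R : realType) (X : {fset R}) (hX : (1 < #|` X|)%N) (d : nat).
Implicit Types (t s : site d) (z : config X d) (P : random_field hX d).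

Lemma Xhat1 t z : Xhat X [fset t]%fset z <-> domf z != fset0 /\ t \notin domf z.
Proof. by rewrite /Xhat /= fdisjointX1. Qed.

Lemma specification_on_1f (q : onepoint_system X d) : is_1f_specification q ->
  specification_on (fun z : config X d => domf z != fset0) q.
Proof.
move=> [qP qE]; split=> [t z x z0 tz|t z z0 tz|t s x y z z0 ts tz sz].
- by have [|+ _] := qP t z; [exact/Xhat1|exact].
- by have [|_] := qP t z; first exact/Xhat1.
- by apply: qE => //; split=> //; rewrite fdisjointXU !fdisjointX1 tz.
Qed.

Lemma compatible_marginal_set P (q : onepoint_system X d) t z x :
  positive_field P -> compatible P q -> domf z != fset0 -> t \notin domf z ->
  marginal P (domf z.[t <- x]%fmap) z.[t <- x]%fmap =
  marginal P (domf z) z * q t z x.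
Proof.
move=> P0 Pq z0 tz; rewrite -(Pq t z x); last exact/Xhat1.
by rewrite /onef_distribution dom_setf mulrC divfK// gt_eqF ?P0.
Qed.

(** The marginal on the pair {t, s}, conditioned in the two possible ways. *)
Lemma compatible_site_odds P (q : onepoint_system X d) t s x y :
  is_1f_specification q -> positive_field P -> compatible P q -> t != s ->
  marginal P (domf (single t x)) (single t x) =
  odds q t x s y * marginal P (domf (single s y)) (single s y).
Proof.
move=> hq P0 Pq ts; have st : s != t by rewrite eq_sym.
have E (a b : site d) (v v' : X) : a != b ->
    marginal P (domf (single b v').[a <- v]%fmap) (single b v').[a <- v]%fmap =
    marginal P (domf (single b v')) (single b v') * q a (single b v') v.
  move=> ab.
  by rewrite (compatible_marginal_set _ P0 Pq) ?single_neq0 ?dom_single.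
have := E t s x y ts; rewrite -pairC// E// => tsE.
have q0 := q1_neq0 (specification_on_1f hq).
by rewrite /odds mulrAC [X in X / _]mulrC -tsE mulfK ?q0.
Qed.

Lemma sum_site_marginal P t :
  \sum_x marginal P (domf (single t x)) (single t x) = 1.
Proof.
by rewrite -(marginal_nil P) (@marginal_sum _ _ _ _ P fset0 t) ?in_fset0.
Qed.

(** For the one-site marginals a, b at t and a', b' at s of the two fields,
    equality of the odds gives a b' = b a'; summing over the spin at s gives
    a = b. *)
Lemma compatible_unique P P' (q : onepoint_system X d) : (1 <= d)%N ->
  is_1f_specification q -> positive_field P -> compatible P q ->
  positive_field P' -> compatible P' q -> same_field P' P.
Proof.
move=> hd hq P0 Pq P'0 P'q; apply: eq_marginal_same_field => z.
elim/fmap_rect: z => [|z IH t x tz]; first by rewrite domf0 !marginal_nil.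
have [z0|z0] := eqVneq (domf z) fset0; last first.
  rewrite (compatible_marginal_set _ P0 Pq)//.
  by rewrite (compatible_marginal_set _ P'0 P'q)// IH.
rewrite (fmap_nil z0) -/(single t x).
have [s /andP[st _]] := third_site hd t t; have ts : t != s by rewrite eq_sym.
(* each side is multiplied by the total mass of the other field at s *)
rewrite -[LHS]mulr1 -(sum_site_marginal P s).
rewrite -[RHS]mulr1 -(sum_site_marginal P' s).
rewrite !mulr_sumr; apply: eq_bigr => y _.
rewrite (compatible_site_odds x y hq P0 Pq ts).
rewrite (compatible_site_odds x y hq P'0 P'q ts).
by rewrite mulrAC.
Qed.

End Compatibility.

Theorem theorem6 (R : realType) (X : {fset R}) (hX : (1 < #|` X|)%N)
    (d : nat) (hd : (1 <= d)%N)
    (q : onepoint_system X d) (hq : is_1f_specification q) :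
  exists P : random_field hX d,
    [/\ positive_field P,
        compatible P q
      & forall P' : random_field hX d,
          positive_field P' -> compatible P' q -> same_field P' P].
Proof.
have q1 := specification_on_1f hq; have third := third_site hd.
have qfull := completion_spec q1 third (spin0 hX).
pose w : config X d -> R := weight (completion q third).
have w0 z : 0 < w z := weight_gt0 qfull z.
pose P := extension hX (fun z => ltW (w0 z)) (weight_nil _) (weight_sum qfull).
have wP z : marginal P (domf z) z = w z by exact: marginal_extension.
have P0 : positive_field P by move=> V z <-; rewrite wP.
have Pq : compatible P q.
  move=> t z x /Xhat1[z0 tz]; rewrite /onef_distribution -(dom_setf z t x) !wP.
  rewrite /w (weight_set qfull)// mulrAC divff ?gt_eqF// mul1r.
  by rewrite /completion (negPf z0).
exists P; split=> // P' P'0 P'q.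
exact: compatible_unique hd hq P0 Pq P'0 P'q.
Qed.
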